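(* Let $\psi:\mathbb{N}\to\mathbb{R}^+$ be an arbitrary function with $\lim_{n\to\infty}\psi(n)=\infty$, and let $$E_{\inf}(\psi)=\Big\{x\in(0,1]:\liminf_{n\to\infty}\frac{\log d_n(x)}{\psi(n)}=1\Big\}.$$ Then $\dim_H E_{\inf}(\psi)=\frac{1}{1+V}$, where $V$ is given by $\log V=\limsup_{n\to\infty}\frac{\log\psi(n)}{n}$.
   Context: Lüroth expansion: the Lüroth map $T:(0,1]\to(0,1]$ is $T(x)=d_1(x)(d_1(x)-1)\big(x-\frac{1}{d_1(x)}\big)$ with $d_1(x)=\lfloor 1/x\rfloor+1$, and the digits are $d_n(x)=d_1(T^{n-1}(x))$ for $n\ge2$. Every $x\in(0,1]$ then has the expansion $x=\frac{1}{d_1}+\frac{1}{d_1(d_1-1)d_2}+\cdots+\frac{1}{d_1(d_1-1)\cdots d_{n-1}(d_{n-1}-1)d_n}+\cdots$ with all digits $d_n(x)\ge2$. Here $\log$ is the natural logarithm and $\dim_H$ denotes Hausdorff dimension. $V\in[1,\infty]$, with $\frac{1}{1+V}$ read as $0$ when $V=\infty$. *)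

(* Defs.v *)
From mathcomp Require Import all_boot all_order all_algebra.
From mathcomp Require Import all_classical all_reals all_analysis.

Set Implicit Arguments.
Unset Strict Implicit.
Unset Printing Implicit Defensive.

Import Order.TTheory GRing.Theory Num.Theory.
Import numFieldNormedType.Exports.

Local Open Scope classical_set_scope.
Local Open Scope ring_scope.

Definition luroth_digit1 (R : realType) (x : R) : int := Num.floor x^-1 + 1.

Definition luroth_map (R : realType) (x : R) : R :=
  let d : R := (luroth_digit1 x)%:~R in d * (d - 1) * (x - d^-1).

(* Digits are numbered from 1; the value at n = 0 is irrelevant. *)
Definition luroth_digit (R : realType) (n : nat) (x : R) : int :=
  luroth_digit1 (iter n.-1 (@luroth_map R) x).

Definition E_inf (R : realType) (psi : nat -> R) : set R :=
  [set x | 0 < x <= 1 /\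
    limn_einf (fun n => (ln (luroth_digit n x)%:~R / psi n)%:E) = 1%E].

(* The diameter of the empty set is -oo. *)
Definition diameter (R : realType) (U : set R) : \bar R :=
  ereal_sup [set `|x - y|%:E | x in U & y in U].

(* The empty set contributes 0 even for s = 0, whereas a singleton contributes
   0 `^ 0 = 1 there. *)
Definition hausdorff_gauge (R : realType) (s : R) (U : set R) : \bar R :=
  if U == set0 then 0%E else (diameter U `^ s)%E.

Definition hausdorff_premeasure (R : realType) (s delta : R) (E : set R) :
    \bar R :=
  ereal_inf [set (\sum_(0 <= i <oo) hausdorff_gauge s (U i))%E | U in
    [set U : (set R)^nat | E `<=` \bigcup_i U i /\
                           forall i, (diameter (U i) <= delta%:E)%E]].

(* The limit as delta tends to 0+ is a supremum, the premeasure being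
   nonincreasing in delta. *)
Definition hausdorff_measure (R : realType) (s : R) (E : set R) : \bar R :=
  ereal_sup [set hausdorff_premeasure s delta E | delta in
    [set delta : R | 0 < delta]].

Definition hausdorff_dim (R : realType) (E : set R) : \bar R :=
  ereal_inf [set s%:E | s in
    [set s : R | 0 <= s /\ hausdorff_measure s E = 0%E]].

(* Main.v *)
Require Import Defs.
From mathcomp Require Import all_boot all_order all_algebra.
From mathcomp Require Import all_classical all_reals all_analysis.
From mathcomp Require Import ring lra.

Set Implicit Arguments.
Unset Strict Implicit.
Unset Printing Implicit Defensive.

Import Order.TTheory GRing.Theory Num.Theory.
Import numFieldNormedType.Exports.

Local Open Scope classical_set_scope.
Local Open Scope ring_scope.

(* Write [e_n = d_n - 1], so that a cylinder of order [n] has length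
   [prod_(i <= n) 1 / (e_i (e_i + 1))].

   Upper bound.  On [E_inf psi] the digits tend to infinity, and for [1 < b < V]
   (or [b = 1]) the inequality [e_(n+1) >= (e_1 ... e_n)^(b-1)] holds for
   infinitely many [n]: otherwise [ln (e_1 ... e_n)] would be [O(b^n)], whereas
   [ln d_n >= psi n / 2] exceeds [c^n / 2] infinitely often for [b < c < V].
   The points of a cylinder satisfying this inequality lie within
   [(e_1 ... e_n)^-(1+b)] of each other, and when [s (1 + b) > 1] the sum of
   [(e_1 ... e_n)^-(s (1+b))] over the words with large letters in their second
   half decays geometrically in [n].

   Lower bound.  For [B > V] let [c] be the least majorant of [psi] such that
   [c_(n+1) <= B c_n]; it equals [psi] infinitely often, so all points with
   [e_n] in [[m_n, 2 m_n[], [m_n ~ exp c_n], belong to [E_inf psi].  Reading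
   [e_n - m_n] as the digits of a real number in the mixed base [(m_n)] maps
   these points onto [[0, 1[], and this map is Hoelder of exponent [s] as soon
   as [s (1 + B) < 1].  A cover of [E_inf psi] thus yields a cover of [[0, 1[],
   whose total length is at least [1]. *)

(** * Limits inferior and superior; Hausdorff measure *)

Section limits.
Context {R : realType}.
Implicit Types (u : nat -> \bar R) (l : \bar R).

Lemma limn_esup_lt_near u l :
  (limn_esup u < l)%E -> \forall n \near \oo, (u n < l)%E.
Proof.
move=> /ereal_inf_lt[_ [A Aoo <-] Al].
apply: filterS Aoo => n An; apply: le_lt_trans Al.
by apply: ereal_sup_ubound; exists n.
Qed.

Lemma limn_esup_gt_frequently u l N :
  (l < limn_esup u)%E -> exists2 n, (N <= n)%N & (l < u n)%E.
Proof.
move=> lu; have : (l < ereal_sup (u @` [set n | (N <= n)%N]))%E.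
  apply: lt_le_trans lu _; apply: ereal_inf_lbound.
  by exists [set n | (N <= n)%N] => //; exists N.
by move=> /ereal_sup_gt[_ [n Nn <-] ?]; exists n.
Qed.

Lemma limn_einf_gt_near u l :
  (l < limn_einf u)%E -> \forall n \near \oo, (l < u n)%E.
Proof.
rewrite /limn_einf lteNr => /limn_esup_lt_near.
by apply: filterS => n; rewrite lteN2.
Qed.

Lemma limn_einf_lt_frequently u l N :
  (limn_einf u < l)%E -> exists2 n, (N <= n)%N & (u n < l)%E.
Proof.
rewrite /limn_einf lteNl => /(@limn_esup_gt_frequently _ _ N)[n Nn].
by rewrite lteN2 => ?; exists n.
Qed.

Lemma le_limn_einf u l :
  (\forall n \near \oo, (l <= u n)%E) -> (l <= limn_einf u)%E.
Proof.
move=> [N _ lu]; rewrite leNgt; apply/negP.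
move=> /(@limn_einf_lt_frequently _ _ N)[n Nn]; apply/negP.
by rewrite -leNgt lu.
Qed.

Lemma limn_einf_le u l :
  (forall N, exists2 n, (N <= n)%N & (u n <= l)%E) -> (limn_einf u <= l)%E.
Proof.
move=> ul; rewrite leNgt; apply/negP => /limn_einf_gt_near[N _ lu].
have [n Nn] := ul N; apply/negP; rewrite -ltNge; exact: lu.
Qed.

End limits.

Section hausdorff.
Context {R : realType}.
Implicit Types (s : R) (E U : set R).

Lemma diameter_le U (r : \bar R) :
  (forall x y, U x -> U y -> (`|x - y|%:E <= r)%E) -> (diameter U <= r)%E.
Proof.
move=> Ur; apply: ge_ereal_sup => _ [x Ux [y Uy <-]]; exact: Ur.
Qed.

Lemma le_diameter U x y : U x -> U y -> (`|x - y|%:E <= diameter U)%E.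
Proof. by move=> Ux Uy; apply: ereal_sup_ubound; exists x => //; exists y. Qed.

Lemma diameter_set0 : diameter (@set0 R) = -oo%E.
Proof.
by apply/eqP; rewrite -leeNy_eq; apply: diameter_le.
Qed.

Lemma diameter_ge0 U : U !=set0 -> (0 <= diameter U)%E.
Proof.
move=> [x Ux]; apply: le_trans (le_diameter Ux Ux).
by rewrite subrr normr0.
Qed.

Lemma hausdorff_gauge_ge0 s U : (0 <= hausdorff_gauge s U)%E.
Proof. by rewrite /hausdorff_gauge; case: ifP => // _; exact: poweR_ge0. Qed.

Lemma hausdorff_gauge_set0 s : hausdorff_gauge s (@set0 R) = 0%E.
Proof. by rewrite /hausdorff_gauge eqxx. Qed.

Lemma hausdorff_gauge_le s U (r : R) : 0 <= s -> 0 <= r ->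
  (diameter U <= r%:E)%E -> (hausdorff_gauge s U <= (r `^ s)%:E)%E.
Proof.
move=> s0 r0 Ur; rewrite /hausdorff_gauge; case: ifPn => [_|U0].
  by rewrite lee_fin powR_ge0.
have d0 : (0 <= diameter U)%E by apply: diameter_ge0; exact/set0P.
by rewrite -poweR_EFin gt0_ler_poweR // ?in_itv /= ?andbT ?d0 ?leey ?lee_fin ?r0.
Qed.

Lemma hausdorff_premeasure_ge0 s (delta : R) E :
  (0 <= hausdorff_premeasure s delta E)%E.
Proof.
apply: le_ereal_inf_tmp => _ [U _ <-]; apply: nneseries_ge0 => n _ _.
exact: hausdorff_gauge_ge0.
Qed.

(* For [s > 0] the constraint on the diameters is automatic, as each of them is
   at most [eps `^ s^-1]. *)
Lemma hausdorff_measure_eq0 s E : 0 < s ->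
  (forall eps : R, 0 < eps -> exists U : (set R)^nat,
    E `<=` \bigcup_i U i /\
    (\sum_(0 <= i <oo) hausdorff_gauge s (U i) <= eps%:E)%E) ->
  hausdorff_measure s E = 0%E.
Proof.
move=> s0 cov; apply/eqP; rewrite eq_le; apply/andP; split; last first.
  apply: le_trans (hausdorff_premeasure_ge0 s 1 E) _.
  by apply: ereal_sup_ubound; exists 1 => //=; exact: ltr01.
apply: ge_ereal_sup => _ [delta /= d0 <-].
apply/lee_addgt0Pr => eps e0; rewrite add0e.
have m0 : 0 < Num.min eps (delta `^ s) by rewrite lt_min e0 powR_gt0.
have [U [EU Us]] := cov _ m0.
apply: ereal_inf_le.
exists (\sum_(0 <= i <oo) hausdorff_gauge s (U i))%E; last first.
  by apply: le_trans Us _; rewrite lee_fin ge_min lexx.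
exists U => //; split => // i.
have [->|Ui0] := eqVneq (U i) set0; first by rewrite diameter_set0 leNye.
have gi : (hausdorff_gauge s (U i) <= (delta `^ s)%:E)%E.
  apply: le_trans (le_trans Us _); last by rewrite lee_fin ge_min lexx orbT.
  rewrite (@nneseriesD1 _ _ i)//; last by move=> *; exact: hausdorff_gauge_ge0.
  by rewrite leeDl //; apply: nneseries_ge0 => *; exact: hausdorff_gauge_ge0.
move: gi; rewrite /hausdorff_gauge (negbTE Ui0) -poweR_EFin.
have di0 : (0 <= diameter (U i))%E by apply: diameter_ge0; exact/set0P.
rewrite leNgt => gi; rewrite leNgt; apply: contra gi.
case: (diameter (U i)) di0 => [r| |]//; rewrite ?lee_fin => r0.
  rewrite !poweR_EFin !lte_fin => dr.
  by apply: gt0_ltr_powR => //; rewrite nnegrE ltW.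
by move=> _; rewrite poweRyr ?gt_eqF// poweR_EFin ltry.
Qed.

(* A lower bound through a parametrisation: [g] is the inverse of a Hoelder map
   sending [g @` `[0, 1[] onto [`[0, 1[]. *)
Lemma hausdorff_measure_gt0 s (C : R) E (g : R -> R) : 0 <= s -> 0 < C ->
  (forall t, 0 <= t < 1 -> E (g t)) ->
  (forall t u, 0 <= t < 1 -> 0 <= u < 1 ->
     `|t - u| <= C * `|g t - g u| `^ s) ->
  (0 < hausdorff_measure s E)%E.
Proof.
move=> s0 C0 gE gC.
suff : ((2 * C)^-1%:E <= hausdorff_premeasure s 1 E)%E.
  move=> le1; apply: lt_le_trans (le_trans le1 _).
    by rewrite lte_fin invr_gt0 mulr_gt0.
  by apply: ereal_sup_ubound; exists 1 => //=; exact: ltr01.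
apply: le_ereal_inf_tmp => _ [U [EU dU] <-].
rewrite -[X in (X <= _)%E]mule1 lee_pdivrMl ?mulr_gt0//.
(* [B i] is centred at one parameter [t] with [g t] in [U i]; the Hoelder bound places every other
   such parameter in it. Its length is [2 * C] times the gauge of [U i], whence the constant in the
   lower bound. *)
pose B i : set R := if pselect (exists2 t, 0 <= t < 1 & U i (g t)) is left e then
  let t := sval (cid2 e) in let r := C * fine (hausdorff_gauge s (U i)) in
  [set` `[t - r, t + r]] else set0.
have mB i : measurable (B i).
  by rewrite /B; case: pselect => // e; exact: measurable_itv.
have B01 : [set` `[0, 1[] `<=` \bigcup_i B i.
  move=> t; rewrite /= in_itv /= => t01.
  have [i _ Ui] := EU _ (gE _ t01); exists i => //.
  rewrite /B; case: pselect => [e|[]]; last by exists t.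
  case: (cid2 e) => u u01 Uu /=; rewrite in_itv /=.
  have U0 : U i !=set0 by exists (g t).
  have dfin : diameter (U i) \is a fin_num.
    by rewrite ge0_fin_numE ?diameter_ge0// (le_lt_trans (dU i)) ?ltry.
  have : `|t - u| <= C * fine (hausdorff_gauge s (U i)).
    apply: le_trans (gC _ _ t01 u01) _; rewrite ler_pM2l//.
    rewrite /hausdorff_gauge ifF; last by apply/negbTE/set0P.
    rewrite -lee_fin fineK ?fin_num_poweR// -poweR_EFin.
    apply: gt0_ler_poweR; rewrite ?in_itv/= ?leey ?andbT ?lee_fin//.
      exact: diameter_ge0.
    exact: le_diameter.
  by rewrite ler_norml; lra.
have mu1 : lebesgue_measure [set` `[0, 1[] = 1%E :> \bar R.
  by rewrite lebesgue_measure_itv /= lte01 oppr0 adde0.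
have leB : (lebesgue_measure [set` `[0%R, 1%R : R[] <=
    \sum_(0 <= i <oo) lebesgue_measure (B i))%E.
  exact: (@measure_sigma_subadditive _ _ _ (@lebesgue_measure R) _
    B mB (measurable_itv _) B01).
rewrite -mu1; apply: le_trans leB _.
rewrite -nneseriesZl; last by move=> *; exact: hausdorff_gauge_ge0.
apply: lee_nneseries => // i _.
rewrite /B; case: pselect => [e|_]; last first.
  by rewrite measure0 mule_ge0 ?hausdorff_gauge_ge0// lee_fin mulr_ge0 ?ltW.
case: (cid2 e) => t _ Ut /=; rewrite lebesgue_measure_itv /=.
have U0 : U i !=set0 by exists (g t).
have gfin : hausdorff_gauge s (U i) \is a fin_num.
  rewrite /hausdorff_gauge ifF; last by apply/negbTE/set0P.
  apply: fin_num_poweR.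
  by rewrite ge0_fin_numE ?diameter_ge0// (le_lt_trans (dU i)) ?ltry.
move: gfin (hausdorff_gauge_ge0 s (U i)).
case: (hausdorff_gauge s (U i)) => [r| |]//= _; rewrite lee_fin => r0.
case: ifP => _; last by rewrite -EFinM lee_fin !mulr_ge0 ?(ltW C0).
by rewrite -EFinB -EFinM lee_fin; lra.
Qed.

End hausdorff.

(** * Lueroth expansions *)

Section luroth.
Context {R : realType}.
Implicit Types x y : R.

(** In the notation above this is [e_(n+1) = d_(n+1) - 1]: the numbering starts at 0. *)
Definition luroth_index (n : nat) x : nat :=
  `|Num.floor (iter n (@luroth_map R) x)^-1|%N.

(** With [d = floor (1/x)] the map is [d ((d + 1) x - 1)], where [1/(d + 1) < x <= 1/d]. *)
Lemma luroth_map_gt0_le1 x : 0 < x <= 1 -> 0 < luroth_map x <= 1.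
Proof.
move=> /andP[x0 x1]; rewrite /luroth_map /luroth_digit1.
set d := Num.floor x^-1.
have /andP[dx xd] : d%:~R <= x^-1 < (d + 1)%:~R := floor_itv x^-1.
have d1 : 1 <= d%:~R :> R.
  have -> : 1 = (1 : int)%:~R :> R by [].
  by rewrite ler_int floor_ge_int_tmp invf_ge1.
rewrite intrD in xd.
have d0 : 0 < d%:~R :> R by lra.
have D0 : 0 < d%:~R + 1 :> R by lra.
have -> : (d + 1)%:~R * ((d + 1)%:~R - 1) * (x - (d + 1)%:~R^-1) =
    d%:~R * ((d%:~R + 1) * x - 1) :> R.
  by rewrite intrD; field; rewrite gt_eqF.
have dx' : d%:~R * x <= 1 by rewrite -ler_pdivlMr// mul1r.
have xd' : 1 < (d%:~R + 1) * x by rewrite -ltr_pdivrMr// mul1r.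
apply/andP; split; nra.
Qed.

Lemma luroth_iter_gt0_le1 n x : 0 < x <= 1 ->
  0 < iter n (@luroth_map R) x <= 1.
Proof. by move=> x01; elim: n => //= n; exact: luroth_map_gt0_le1. Qed.

Lemma luroth_digit_index n x : 0 < x <= 1 ->
  luroth_digit n.+1 x = (luroth_index n x).+1%:Z.
Proof.
move=> /(luroth_iter_gt0_le1 n)/andP[y0 y1].
rewrite /luroth_digit /luroth_index /luroth_digit1 /=.
rewrite -addn1 PoszD gez0_abs// floor_ge0 invr_ge0 ltW//.
Qed.

Lemma luroth_index_gt0 n x : 0 < x <= 1 -> (0 < luroth_index n x)%N.
Proof.
move=> /(luroth_iter_gt0_le1 n)/andP[y0 y1].
by rewrite /luroth_index absz_gt0 gt_eqF// floor_gt0 invf_ge1.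
Qed.

Lemma luroth_iter_le n x : 0 < x <= 1 ->
  iter n (@luroth_map R) x <= (luroth_index n x)%:R^-1.
Proof.
move=> x01; have /andP[y0 y1] := luroth_iter_gt0_le1 n x01.
have e0 := luroth_index_gt0 n x01.
rewrite -[leLHS]invrK lef_pV2 ?posrE ?invr_gt0 ?ltr0n//.
rewrite /luroth_index natr_absz ger0_norm ?floor_ge0 ?invr_ge0 ?(ltW y0)//.
exact: floor_le_tmp.
Qed.

Lemma luroth_iterS n x : 0 < x <= 1 -> iter n.+1 (@luroth_map R) x =
  (luroth_index n x * (luroth_index n x).+1)%:R * iter n (@luroth_map R) x
  - (luroth_index n x)%:R.
Proof.
move=> x01; have := luroth_digit_index n x01.
rewrite iterS /luroth_map /luroth_digit /= => ->.
have : (luroth_index n x).+1%:R != 0 :> R by rewrite pnatr_eq0.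
rewrite natrM -[(luroth_index n x).+1%:Z%:~R]/((luroth_index n x).+1%:R).
by rewrite -natr1 => h; field.
Qed.

(** Each step is an affine map [y -> e (e + 1) y - e]; on a common cylinder the constants cancel and
    the slopes multiply. *)
Lemma luroth_iter_sub n x y : 0 < x <= 1 -> 0 < y <= 1 ->
  (forall i, (i < n)%N -> luroth_index i x = luroth_index i y) ->
  iter n (@luroth_map R) x - iter n (@luroth_map R) y =
  (\prod_(i < n) (luroth_index i x * (luroth_index i x).+1))%:R * (x - y).
Proof.
move=> x01 y01; elim: n => [|n IH] exy; first by rewrite big_ord0 mul1r.
rewrite !luroth_iterS// -exy// big_ord_recr /= [in RHS]natrM mulrAC -IH; last first.
  by move=> i ni; rewrite exy// ltnW.
by ring.
Qed.

Section series.
Variable e : nat -> nat.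
Hypothesis e0 : forall n, (0 < e n)%N.

(** Partial sums of the expansion with digits [e k + 1], [e k.+1 + 1], ..., nested as in Horner's
    scheme so that the recursion mirrors the removal of the first digit by the Lueroth map. *)
Fixpoint luroth_sum (n k : nat) : R := if n is n'.+1 then
  (e k).+1%:R^-1 + luroth_sum n' k.+1 / (e k * (e k).+1)%:R else 0.

(** By induction the tail is at most 1, and [1/(e + 1) + 1/(e (e + 1)) = 1/e]. *)
Lemma luroth_sum_itv n k : 0 <= luroth_sum n k <= (e k)%:R^-1.
Proof.
elim: n k => [|n IH] k /=; first by rewrite lexx invr_ge0 ler0n.
have /andP[s0 s1] := IH k.+1.
have ek : 0 < (e k)%:R :> R by rewrite ltr0n.
have {}s1 : luroth_sum n k.+1 <= 1.
  by apply: le_trans s1 _; rewrite invf_le1 ?ltr0n// ler1n.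
rewrite addr_ge0 ?divr_ge0 ?invr_ge0//=.
have -> : (e k)%:R^-1 = (e k).+1%:R^-1 + 1 / (e k * (e k).+1)%:R :> R.
  rewrite natrM -natr1; field.
  by rewrite gt_eqF//= gt_eqF// addr_gt0.
by rewrite lerD2l ler_pM2r// invr_gt0 ltr0n muln_gt0 e0.
Qed.

Lemma luroth_sum_ndecr k : nondecreasing_seq (luroth_sum ^~ k).
Proof.
apply/nondecreasing_seqP => n; elim: n k => [|n IH] k.
  by case/andP: (luroth_sum_itv 1 k).
by rewrite /= lerD2l ler_wpM2r ?invr_ge0.
Qed.

Definition luroth_series k : R := limn (luroth_sum ^~ k).

Lemma luroth_sum_cvg k : luroth_sum ^~ k @ \oo --> luroth_series k.
Proof.
apply: nondecreasing_is_cvgn; first exact: luroth_sum_ndecr.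
exists (e k)%:R^-1 => _ [n _ <-].
by case/andP: (luroth_sum_itv n k).
Qed.

Lemma luroth_seriesE k : luroth_series k =
  (e k).+1%:R^-1 + luroth_series k.+1 / (e k * (e k).+1)%:R.
Proof.
have shift : (fun n => luroth_sum n.+1 k) @ \oo --> luroth_series k.
  by have := @luroth_sum_cvg k; rewrite -cvg_shiftS.
have : (fun n => luroth_sum n.+1 k) @ \oo -->
    (e k).+1%:R^-1 + luroth_series k.+1 / (e k * (e k).+1)%:R.
  apply: cvgD; first exact: cvg_cst.
  by apply: cvgMl; exact: luroth_sum_cvg.
exact: (cvg_unique _ shift).
Qed.

Lemma luroth_series_ge0 k : 0 <= luroth_series k.
Proof.
apply: limr_ge; first exact: luroth_sum_cvg.
by near=> n; case/andP: (luroth_sum_itv n k).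
Unshelve. all: by end_near. Qed.

Lemma luroth_series_gt0 k : 0 < luroth_series k.
Proof.
rewrite luroth_seriesE ltr_pwDl ?invr_gt0//.
by rewrite divr_ge0 ?luroth_series_ge0.
Qed.

Lemma luroth_series_le k : luroth_series k <= (e k)%:R^-1.
Proof.
apply: limr_le; first exact: luroth_sum_cvg.
by near=> n; case/andP: (luroth_sum_itv n k).
Unshelve. all: by end_near. Qed.

Lemma luroth_series_le1 k : luroth_series k <= 1.
Proof.
by apply: le_trans (luroth_series_le k) _; rewrite invf_le1 ?ltr0n// ler1n.
Qed.

(** The value lies in []1/(e k + 1), 1/e k]]; the left end is excluded because the tail is
    positive. *)
Lemma floor_inv_luroth_series k : Num.floor (luroth_series k)^-1 = e k.
Proof.
have s0 := luroth_series_gt0 k.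
apply: floor_def; apply/andP; split.
  rewrite -[leLHS]invrK lef_pV2 ?posrE ?invr_gt0 ?ltr0n//.
  exact: luroth_series_le.
have -> : ((e k)%:Z + 1)%:~R = (e k).+1%:R :> R by rewrite intrD natr1.
rewrite -[ltRHS]invrK ltf_pV2 ?posrE ?invr_gt0 ?ltr0n//.
rewrite luroth_seriesE ltrDl divr_gt0 ?luroth_series_gt0//.
by rewrite ltr0n muln_gt0 e0.
Qed.

Lemma luroth_iter_series n :
  iter n (@luroth_map R) (luroth_series 0) = luroth_series n.
Proof.
elim: n => //= n ->; rewrite /luroth_map /luroth_digit1.
rewrite floor_inv_luroth_series intrD {1}luroth_seriesE natrM -natr1.
have ek : 0 < (e n)%:R :> R by rewrite ltr0n.
field.
by rewrite gt_eqF//= gt_eqF// addr_gt0.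
Qed.

(** Every sequence of positive integers is thus an index sequence; the lower bound builds its points
    this way. *)
Lemma luroth_index_series n : luroth_index n (luroth_series 0) = e n.
Proof. by rewrite /luroth_index luroth_iter_series floor_inv_luroth_series. Qed.

End series.

End luroth.

(** * Sums over words *)

Section countable_sums.
Context {R : realType}.

Lemma le_esumZl (T : choiceType) (A : set T) (c : R) (a : T -> \bar R) :
  0 <= c -> (forall i, A i -> 0 <= a i)%E ->
  (\esum_(i in A) (c%:E * a i) <= c%:E * \esum_(i in A) a i)%E.
Proof.
move=> c0 a0; apply: ge_ereal_sup => _ [X [finX XA] <-].
rewrite fsbig_finite//= big_seq -ge0_sume_distrr; last first.
  by move=> i; rewrite in_fset_set// inE => /XA; exact: a0.
rewrite lee_wpmul2l ?lee_fin// -big_seq -fsbig_finite//.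
by apply: ereal_sup_ubound; exists X.
Qed.

(** The coding [pickle] turns the cover into a sequence; numbers that code no element of [J] receive
    the empty set, whose gauge is 0. *)
Lemma hausdorff_measure_eq0_countable (T : countType) (s : R) (E : set R) :
  0 < s ->
  (forall eps : R, 0 < eps -> exists (J : set T) (U : T -> set R),
    E `<=` \bigcup_(i in J) U i /\
    (\esum_(i in J) hausdorff_gauge s (U i) <= eps%:E)%E) ->
  hausdorff_measure s E = 0%E.
Proof.
move=> s0 cov; apply: hausdorff_measure_eq0 => // eps /cov[J [U [EU Ueps]]].
exists (fun n => if pickle_inv n is Some i then
  if i \in J then U i else set0 else set0); split.
  move=> x /EU[i Ji Ux]; exists (pickle i) => //=.
  by rewrite pickleK_inv mem_set.
apply: le_trans Ueps.
rewrite nneseries_esumT; last by move=> n; exact: hausdorff_gauge_ge0.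
rewrite (_ : \esum_(i in J) _ = \esum_(n in pickle @` J)
    hausdorff_gauge s (if pickle_inv n is Some i then
      if i \in J then U i else set0 else set0))%E; last first.
  rewrite esum_image; last by move=> ? ? _ _; exact: (pcan_inj pickleK_inv).
  by apply: eq_esum => i Ji; rewrite pickleK_inv mem_set.
rewrite [leRHS]esum_mkcond; apply: le_esum => n _.
case: ifPn => // nJ.
case: (pickle_inv n) (@pickle_invK T n) => [i /=|]; last first.
  by rewrite hausdorff_gauge_set0.
move=> ni; case: ifPn; last by rewrite hausdorff_gauge_set0.
rewrite inE => Ji; move: nJ; rewrite notin_setE; case.
by exists i.
Qed.

End countable_sums.

Section words.
Context {R : realType}.

Definition cons_words (A : set nat) (L : set (seq nat)) : set (seq nat) :=
  [set w | exists a v, [/\ A a, L v & w = a :: v]].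

(** The free letters come first: when the letters of an infinite sequence tend to infinity, its long
    prefixes have large letters throughout their second half. *)
Definition words (M h m : nat) : set (seq nat) :=
  iter h (cons_words setT) (iter m (cons_words [set e | (M <= e)%N]) [set [::]]).

Lemma size_iter_cons_words A L h k : (forall w, L w -> size w = k) ->
  forall w, iter h (cons_words A) L w -> size w = (h + k)%N.
Proof.
move=> Lk; elim: h => [|h IH] w //=; first exact: Lk.
by move=> [a [v [_ /IH vk ->]]]; rewrite /= vk.
Qed.

Lemma size_words M h m w : words M h m w -> size w = (h + m)%N.
Proof.
apply: size_iter_cons_words => v /(size_iter_cons_words (k := 0)).
by rewrite addn0; apply => ? ->.
Qed.

Lemma words_cat M w1 w2 : all (leq M) w2 -> words M (size w1) (size w2) (w1 ++ w2).
Proof.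
move=> w2M; elim: w1 => [|a w1 IH] /=; last by exists a, (w1 ++ w2).
by elim: w2 w2M => //= a w2 IH /andP[Ma /IH w2M]; exists a, w2.
Qed.

Variable f : nat -> R.
Hypothesis f0 : forall e, 0 <= f e.

Let F (w : seq nat) : R := \prod_(e <- w) f e.

Let F0 w : 0 <= F w. Proof. by apply: prodr_ge0. Qed.

(** The weight is multiplicative and [(e, w) -> e :: w] is injective, so the sum becomes a double
    sum that factors. *)
Lemma esum_cons_words (A : set nat) (L : set (seq nat)) (a c : R) :
  0 <= a -> 0 <= c ->
  (\esum_(e in A) (f e)%:E <= a%:E)%E -> (\esum_(w in L) (F w)%:E <= c%:E)%E ->
  (\esum_(w in cons_words A L) (F w)%:E <= (a * c)%:E)%E.
Proof.
move=> a0 c0 Aa Lc.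
rewrite (reindex_esum (A `*`` (fun=> L)) _ (fun p => p.1 :: p.2)); last first.
  split => /=.
  - by move=> [x v] /= [Ax Lv]; exists x, v.
  - by move=> [x v] [y w] _ _ /= [-> ->].
  - by move=> _ [x [v [Ax Lv ->]]]; exists (x, v).
rewrite (_ : \esum_(i in _) _ =
    \esum_(k in A `*`` (fun=> L)) (fun x v => (f x)%:E * (F v)%:E) k.1 k.2)%E; last first.
  by apply: eq_esum => -[x v] _ /=; rewrite /F big_cons EFinM.
rewrite -(@esum_esum _ _ _ A (fun=> L) (fun x v => (f x)%:E * (F v)%:E)%E); last first.
  by move=> *; rewrite mule_ge0// lee_fin.
apply: (@le_trans _ _ (\esum_(x in A) (c%:E * (f x)%:E))%E).
  apply: le_esum => x Ax; apply: le_trans (le_esumZl _ _) _ => //.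
    by move=> *; rewrite lee_fin.
  by rewrite muleC lee_wpmul2r// lee_fin.
apply: le_trans (le_esumZl _ _) _ => //; first by move=> *; rewrite lee_fin.
by rewrite mulrC EFinM lee_wpmul2l// lee_fin.
Qed.

Lemma esum_words M h m (Z q : R) : 0 <= Z -> 0 <= q ->
  (\esum_(e in setT) (f e)%:E <= Z%:E)%E ->
  (\esum_(e in [set e | (M <= e)%N]) (f e)%:E <= q%:E)%E ->
  (\esum_(w in words M h m) (F w)%:E <= (Z ^+ h * q ^+ m)%:E)%E.
Proof.
move=> Z0 q0 fZ fq; elim: h => [|h IH] /=; last first.
  by rewrite exprS -mulrA; apply: esum_cons_words => //; rewrite mulr_ge0 ?exprn_ge0.
rewrite mul1r; elim: m => [|m IH] /=; last first.
  by rewrite exprS; apply: esum_cons_words => //; rewrite exprn_ge0.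
by rewrite esum_set1 ?lee_fin// /F big_nil.
Qed.

(* As [n - n./2 >= n./2] and [Z >= 1], the words of length [n] weigh at most
   [(q * Z) ^+ (n - n./2) <= 2 ^- n]. *)
Lemma esum_half_words M (Z q : R) n0 : 1 <= Z -> 0 <= q -> q * Z <= 4^-1 ->
  (\esum_(e in setT) (f e)%:E <= Z%:E)%E ->
  (\esum_(e in [set e | (M <= e)%N]) (f e)%:E <= q%:E)%E ->
  (\esum_(w in \bigcup_(n in [set n | (n0 <= n)%N]) words M n./2 (n - n./2))
     (F w)%:E <= (2 / 2 ^+ n0)%:E)%E.
Proof.
move=> Z1 q0 qZ fZ fq; have Z0 : 0 <= Z by exact: le_trans Z1.
have half_le n : (n./2 <= n)%N.
  by rewrite -{2}(odd_double_half n) -addnn addnA leq_addl.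
(* The union is disjoint, since the length of a word determines [n]. *)
rewrite esum_bigcupT; last 2 first.
- move=> i j _ _ [w [/size_words wi /size_words wj]].
  by move: wi wj; rewrite !subnKC// => -> ->.
- by move=> w; rewrite lee_fin.
apply: (@le_trans _ _ (\esum_(n in [set n | (n0 <= n)%N]) (2 ^- n)%:E)%E).
  apply: le_esum => n _; apply: le_trans (esum_words _ _ _ _ fZ fq) _ => //.
  have hh : (n./2 <= n - n./2)%N.
    by rewrite -{2}(odd_double_half n) -addnn addnA addnK leq_addl.
  rewrite lee_fin; apply: (@le_trans _ _ ((q * Z) ^+ (n - n./2))).
    rewrite exprMn mulrC ler_wpM2l ?exprn_ge0//.
    exact: ler_weXn2l.
  apply: (@le_trans _ _ (4^-1 ^+ (n - n./2))).
    by apply: lerXn2r => //; rewrite nnegrE ?mulr_ge0.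
  have -> : 4 = 2 ^+ 2 :> R by rewrite -natrX.
  rewrite exprVn -exprM lef_pV2 ?posrE ?exprn_gt0//.
  apply: ler_weXn2l; first by rewrite ler1n.
  by rewrite mul2n -addnn -{1}(subnKC (half_le n)) leq_add2r.
rewrite (reindex_esum setT _ (fun k => k + n0)%N); last first.
  split => /=.
  - by move=> k _ /=; rewrite leq_addl.
  - by move=> i j _ _ /eqP; rewrite eqn_add2r => /eqP.
  - by move=> n n0n; exists (n - n0)%N => //=; rewrite subnK.
rewrite -nneseries_esumT; last by move=> k; rewrite lee_fin invr_ge0 exprn_ge0.
have /cvg_lim <- // := @cvg_geometric_eseries_half R 2 n0.
rewrite le_eqVlt; apply/orP; left; apply/eqP.
congr (limn _); apply/funext => k; apply: eq_bigr => i _; congr EFin.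
by rewrite addnS expnS natrM natrX invfM mulrA divff// mul1r.
Qed.

End words.

(** * Convergence and tails of the zeta series *)

Section zeta.
Context {R : realType}.
Variable tau : R.
Hypothesis tau1 : 1 < tau.

(* The term [e = 0] vanishes, since [0 `^ tau = 0] and [0^-1 = 0]. *)
Definition zeta_term (e : nat) : R := (e%:R `^ tau)^-1.

Lemma zeta_term_ge0 e : 0 <= zeta_term e.
Proof. by rewrite invr_ge0 powR_ge0. Qed.

(** Cauchy condensation: the block from [2 ^ k] to [2 ^ k.+1] has [2 ^ k] terms, each at most
    [2^(- k tau)], so the blocks are dominated by a geometric series of ratio [2^(1 - tau) < 1]. *)
Lemma sum_zeta_term_dyadic k :
  \sum_(0 <= e < 2 ^ k) zeta_term e <= (1 - 2 / 2 `^ tau)^-1.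
Proof.
have tau0 : tau != 0 by rewrite gt_eqF// (lt_trans ltr01).
set r : R := 2 / 2 `^ tau.
have r0 : 0 <= r by rewrite divr_ge0 ?powR_ge0.
have r1 : r < 1.
  rewrite /r ltr_pdivrMr ?powR_gt0// mul1r -ltr_ln ?posrE ?powR_gt0//.
  by rewrite ln_powR ltr_pMl ?ln_gt0 ?ltr1n.
suff : \sum_(0 <= e < 2 ^ k) zeta_term e <= \sum_(j < k) r ^+ j.
  move=> /le_trans; apply.
  rewrite -[leRHS]mul1r ler_pdivlMr ?subr_gt0//.
  by have := subrX1 r k; have := exprn_ge0 k r0; lra.
elim: k => [|k IH].
  by rewrite big_ord0 expn0 big_nat1 /zeta_term powR0// invr0.
rewrite big_ord_recr /= (big_cat_nat _ (n := 2 ^ k)) ?leq_exp2l//=.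
rewrite lerD//.
have -> : r ^+ k = \sum_(2 ^ k <= e < 2 ^ k.+1) (2 `^ tau ^+ k)^-1.
  rewrite sumr_const_nat expnS mul2n -addnn addnK -[RHS]mulr_natl.
  by rewrite natrX /r exprMn exprVn.
rewrite !big_nat; apply: ler_sum => e /andP[ke _].
rewrite /zeta_term lef_pV2 ?posrE ?exprn_gt0 ?powR_gt0 ?ltr0n//; last first.
  by rewrite (leq_trans _ ke)// expn_gt0.
rewrite -powR_mulrn ?powR_ge0// powRAC powR_mulrn// -natrX.
by rewrite ge0_ler_powR ?nnegrE ?ler_nat// (le_trans ler01)// ltW.
Qed.

Lemma zeta_fin : (\sum_(0 <= e <oo) (zeta_term e)%:E < +oo)%E.
Proof.
apply: (@le_lt_trans _ _ (1 - 2 / 2 `^ tau)^-1%:E); last by rewrite ltry.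
apply: lime_le.
  by apply: is_cvg_nneseries => n _ _; rewrite lee_fin zeta_term_ge0.
apply: nearW => n; apply: le_trans (_ : _ <= \sum_(0 <= e < 2 ^ n) (zeta_term e)%:E)%E _.
  apply: lee_sum_nneg_natr => [k _ _|]; first by rewrite lee_fin zeta_term_ge0.
  by rewrite ltnW// ltn_expl.
by rewrite sumEFin lee_fin sum_zeta_term_dyadic.
Qed.

(** These are the constants for [esum_half_words]: [Z] is fixed first, then [M] is taken so large
    that the tail is below [q = 1/(4 Z)]. *)
Lemma zeta_bounds : exists M (Z q : R),
  [/\ 1 <= Z, 0 <= q, q * Z <= 4^-1,
    (\esum_(e in setT) (zeta_term e)%:E <= Z%:E)%E &
    (\esum_(e in [set e | (M <= e)%N]) (zeta_term e)%:E <= q%:E)%E].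
Proof.
have z0 e : (0 <= (zeta_term e)%:E)%E by rewrite lee_fin zeta_term_ge0.
have : exists Z : R, 1 <= Z /\ (\esum_(e in setT) (zeta_term e)%:E <= Z%:E)%E.
  rewrite -nneseries_esumT//; move: zeta_fin.
  have : (0 <= \sum_(0 <= e <oo) (zeta_term e)%:E)%E by apply: nneseries_ge0.
  case: (limn _) => // z _ _; exists (Num.max 1 z).
  by rewrite le_max lexx lee_fin le_max lexx orbT.
move=> [Z [Z1 hZ]].
have Z0 : 0 < Z by exact: lt_le_trans Z1.
have := @nneseries_tail_cvg R _ xpredT zeta_fin (fun e _ => z0 e).
move=> /fine_cvgP[tfin].
have q0 : 0 < (4 * Z)^-1 by rewrite invr_gt0 mulr_gt0.
move=> /cvgr_lt /(_ _ q0) tq.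
have [M [tM qM]] := @filter_ex _ _ _ _ (filterI tfin tq).
exists M, Z, (4 * Z)^-1; split => //; first exact: ltW.
  by rewrite invfM mulfVK// gt_eqF.
rewrite (reindex_esum setT _ (fun k => k + M)%N); last first.
  split => /=.
  - by move=> k _ /=; rewrite leq_addl.
  - by move=> i j _ _ /eqP; rewrite eqn_add2r => /eqP.
  - by move=> n n0n; exists (n - M)%N => //=; rewrite subnK.
rewrite -nneseries_esumT// (@nneseries_addn _ (fun e => (zeta_term e)%:E))//.
by rewrite -(fineK tM) lee_fin ltW.
Qed.

End zeta.

(** * Upper bound *)

Section upper.
Context {R : realType}.

Definition luroth_word n (x : R) : seq nat := mkseq (luroth_index ^~ x) n.

(** The bound on the next letter confines the points to the left end of the cylinder; for [b > 1]
    this improves the exponent in the diameter from 2 to [1 + b]. *)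
Definition luroth_cover (b : R) (w : seq nat) : set R :=
  [set x | [/\ 0 < x <= 1, luroth_word (size w) x = w &
    (\prod_(e <- w) e%:R) `^ (b - 1) <= (luroth_index (size w) x)%:R]].

Lemma luroth_word_index n (x y : R) : luroth_word n x = luroth_word n y ->
  forall i, (i < n)%N -> luroth_index i x = luroth_index i y.
Proof.
move=> xy i ni; have := congr1 (nth 0%N ^~ i) xy.
by rewrite !nth_mkseq.
Qed.

Lemma prod_luroth_word n (x : R) : \prod_(e <- luroth_word n x) e%:R =
  \prod_(i < n) (luroth_index i x)%:R :> R.
Proof. by rewrite big_map -{1}(subn0 n) -/(index_iota 0 n) big_mkord. Qed.

(** On the cylinder [T^n] has slope [P >= Q^2], and both images lie in []0, Q^-(b-1)]]. *)
Lemma diameter_luroth_cover (b : R) w :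
  (diameter (luroth_cover b w) <= ((\prod_(e <- w) e%:R) `^ (1 + b))^-1%:E)%E.
Proof.
apply: diameter_le => x y [x01 xw xb] [y01 yw yb]; rewrite lee_fin.
set n := size w in xw xb yw yb.
set Q : R := \prod_(e <- w) e%:R in xb yb *.
have QE : Q = \prod_(i < n) (luroth_index i x)%:R.
  by rewrite /Q -{1}xw prod_luroth_word.
have Q0 : 0 < Q.
  by rewrite QE; apply: prodr_gt0 => i _; rewrite ltr0n luroth_index_gt0.
have := luroth_iter_sub x01 y01 (luroth_word_index (etrans xw (esym yw))).
set P : R := _%:R => xyP.
have QP : Q * Q <= P.
  rewrite /P natr_prod QE -big_split /=; apply: ler_prod => i _.
  by rewrite mulr_ge0 ?ler0n//= -natrM ler_nat leq_mul2l leqnSn orbT.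
have P0 : 0 < P by apply: lt_le_trans QP; rewrite mulr_gt0.
have Kn (z : R) : 0 < z <= 1 -> Q `^ (b - 1) <= (luroth_index n z)%:R ->
    iter n (@luroth_map R) z <= (Q `^ (b - 1))^-1.
  move=> z01 zb; apply: le_trans (luroth_iter_le n z01) _.
  by rewrite lef_pV2 ?posrE ?powR_gt0// ltr0n luroth_index_gt0.
have /andP[Tx0 _] := luroth_iter_gt0_le1 n x01.
have /andP[Ty0 _] := luroth_iter_gt0_le1 n y01.
have Tx := Kn _ x01 xb; have Ty := Kn _ y01 yb.
have : `|P * (x - y)| <= (Q `^ (b - 1))^-1 by rewrite -xyP ler_norml; lra.
rewrite normrM gtr0_norm// mulrC -ler_pdivlMr// => /le_trans; apply.
have -> : 1 + b = (b - 1) + 1 + 1 by ring.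
move: (b - 1) => c; rewrite !(@powRD _ Q) ?(gt_eqF Q0) ?implybT// powRr1 ?(ltW Q0)//.
rewrite -mulrA invfM ler_pM2l ?invr_gt0 ?powR_gt0//.
by rewrite lef_pV2 ?posrE ?mulr_gt0.
Qed.

Lemma hausdorff_gauge_luroth_cover (s b : R) w : 0 <= s ->
  (hausdorff_gauge s (luroth_cover b w) <=
    (\prod_(e <- w) zeta_term (s * (1 + b)) e)%:E)%E.
Proof.
move=> s0; apply: le_trans (hausdorff_gauge_le s0 _ (diameter_luroth_cover b w)) _.
  by rewrite invr_ge0 powR_ge0.
rewrite lee_fin le_eqVlt; apply/orP; left; apply/eqP.
rewrite -powR_inv1 ?powR_ge0// powRAC powR_inv1 ?powR_ge0// -powRrM.
rewrite mulrC /zeta_term prodfV; congr (_^-1).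
elim: w => [|e w IH]; first by rewrite !big_nil powR1.
by rewrite !big_cons powRM ?prodr_ge0// IH.
Qed.

(** A Borel-Cantelli argument: every point lies in covers of infinitely many orders, so the orders
    below [n0] can be discarded, and the others have total gauge at most [2 / 2 ^+ n0]. *)
Lemma hausdorff_measure_luroth_eq0 (s b : R) (E : set R) :
  0 < s -> 1 < s * (1 + b) ->
  (forall x, E x -> [/\ 0 < x <= 1,
    forall M, \forall n \near \oo, (M <= luroth_index n x)%N &
    forall N, exists2 n, (N <= n)%N &
      (\prod_(i < n) (luroth_index i x)%:R) `^ (b - 1) <=
      (luroth_index n x)%:R]) ->
  hausdorff_measure s E = 0%E.
Proof.
move=> s0 sb EP.
have [M [Z [q [Z1 q0 qZ hZ hq]]]] := zeta_bounds sb.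
apply: (@hausdorff_measure_eq0_countable R (seq nat)) => // eps e0.
have [n0 n0P] : exists n0, 2 / 2 ^+ n0 <= eps.
  exists (Num.trunc (2 / eps)).+1.
  rewrite ler_pdivrMr ?exprn_gt0// mulrC -ler_pdivrMr// ltW//.
  apply: lt_trans (truncnS_gt _) _.
  by rewrite -natrX ltr_nat ltn_expl.
exists (\bigcup_(n in [set n | (n0 <= n)%N]) words M n./2 (n - n./2)).
exists (luroth_cover b); split; last first.
  have le_n0 := esum_half_words (@zeta_term_ge0 R _) n0 Z1 q0 qZ hZ hq.
  apply: le_trans (le_trans le_n0 _); last by rewrite lee_fin.
  by apply: le_esum => w _; apply: hausdorff_gauge_luroth_cover; exact: ltW.
(* An order [n >= n0 + 2 N] is admissible, and its second half starts at [n./2 >= N], where all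
   letters are at least [M]. *)
move=> x /EP[x01 /(_ M)[N _ xM] /(_ (n0 + N.*2)%N)[n nN xb]].
have nx : size (luroth_word n x) = n by rewrite size_mkseq.
exists (luroth_word n x); last by split; rewrite ?nx// prod_luroth_word.
exists n; first by rewrite /= (leq_trans (leq_addr _ _) nN).
rewrite -(cat_take_drop n./2 (luroth_word n x)).
have half_le : (n./2 <= n)%N.
  by rewrite -{2}(odd_double_half n) -addnn addnA leq_addl.
have := @words_cat M (take n./2 (luroth_word n x)) (drop n./2 (luroth_word n x)).
rewrite size_takel ?nx// size_drop nx; apply.
apply/(all_nthP 0%N) => i; rewrite size_drop nx ltn_subRL => ni.
rewrite nth_drop nth_mkseq//; apply: xM => /=.
rewrite (leq_trans _ (leq_addr _ _))// -(doubleK N) half_leq//.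
by rewrite (leq_trans (leq_addl _ _) nN).
Qed.

End upper.

Section growth.
Context {R : realType}.

Lemma near_exprn_ge (x A : R) : 1 < x -> \forall n \near \oo, A <= x ^+ n.
Proof.
move=> x1; have x0 : 0 < x by exact: lt_trans x1.
pose A' := Num.max A 1; have A0 : 0 < A' by rewrite lt_max ltr01 orbT.
have : x^-1 ^+ n @[n --> \oo] --> 0.
  by apply: cvg_expr; rewrite gtr0_norm ?invr_gt0// invf_lt1.
move=> /cvgr_lt /(_ A'^-1); rewrite invr_gt0 => /(_ A0).
apply: filterS => n; rewrite exprVn ltf_pV2 ?posrE ?exprn_gt0// => /ltW.
by apply: le_trans; rewrite le_max lexx.
Qed.

End growth.

(** * Digit growth on [E_inf psi] *)

Section E_inf_digits.
Context {R : realType}.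
Variable psi : nat -> R.
Hypothesis psi_gt0 : forall n : nat, (0 < n)%N -> 0 < psi n.
Hypothesis psi_cvg : psi n @[n --> \oo] --> +oo.

Lemma E_inf_ln_index x : E_inf psi x ->
  \forall n \near \oo, psi n.+1 / 2 < ln (luroth_index n x).+1%:R.
Proof.
move=> [x01 lim1].
(* The constant [1/2] serves as a number strictly below the limit inferior 1. *)
have : ((2^-1 : R)%:E < limn_einf (fun n =>
    (ln (luroth_digit n x)%:~R / psi n)%:E))%E.
  by rewrite lim1 lte_fin invf_lt1// ltr1n.
move=> /limn_einf_gt_near[N _ NP]; exists N => // n /= Nn.
have /NP : (N <= n.+1)%N by rewrite leqW.
by rewrite lte_fin luroth_digit_index// ltr_pdivlMr ?psi_gt0// mulrC.
Qed.

Lemma E_inf_index_cvg x : E_inf psi x ->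
  forall M, \forall n \near \oo, (M <= luroth_index n x)%N.
Proof.
move=> /E_inf_ln_index[N _ NP] M.
have /cvgryPge/(_ (2 * ln M.+1%:R))[N' _ NP'] := psi_cvg.
exists (maxn N N') => // n; rewrite /= geq_max => /andP[Nn N'n].
have /NP' : (N' <= n.+1)%N by rewrite leqW.
move=> /= psiM; have := NP _ Nn => /= psie.
rewrite ltnW// -ltnS -(@ltr_nat R) -ltr_ln ?posrE ?ltr0n//; lra.
Qed.

Lemma E_inf_growth (V : \bar R) (b : R) x :
  lne V = limn_esup (fun n : nat => (ln (psi n) / n%:R)%:E) ->
  1 <= b -> b = 1 \/ (b%:E < V)%E -> E_inf psi x ->
  forall N, exists2 n, (N <= n)%N &
      (\prod_(i < n) (luroth_index i x)%:R) `^ (b - 1) <=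
      (luroth_index n x)%:R.
Proof.
move=> lnV b1 bV Ex N; have [x01 _] := Ex.
have e1 n : 1 <= (luroth_index n x)%:R :> R by rewrite ler1n luroth_index_gt0.
have b0 : 0 < b by exact: lt_le_trans b1.
case: bV => [->|bV]; first by exists N => //; rewrite subrr powRr0.
(* The gap between [b] and [c] makes [c^n], a lower bound for [psi n] infinitely often, outgrow the
   [b^n] obtained by contradiction. *)
have [c bc cV] : exists2 c : R, b < c & ((ln c)%:E < lne V)%E.
  case: V bV {lnV} => [v| |]//; rewrite ?lte_fin => bv.
    exists ((b + v) / 2); first lra.
    by rewrite lne_EFin ?lte_fin ?ltr_ln ?posrE; lra.
  by exists (b + 1); [lra|rewrite /= ltry].
pose Q n : R := \prod_(i < n) (luroth_index i x)%:R.
have Q1 n : 1 <= Q n.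
  by apply: (big_ind (fun y => 1 <= y)) => // ? ?; exact: mulr_ege1.
apply: contrapT => nP.
have {}nP n : (N <= n)%N -> (luroth_index n x)%:R < Q n `^ (b - 1).
  by move=> Nn; rewrite ltNge; apply/negP => Qn; apply: nP; exists n.
have Q0 n : 0 < Q n by exact: lt_le_trans (Q1 n).
(* Under the negated claim, [Q n.+1 = Q n * e <= (Q n)^b]. *)
have QS n : (N <= n)%N -> ln (Q n.+1) <= b * ln (Q n).
  move=> /nP en; rewrite -ln_powR ler_ln ?posrE ?powR_gt0//.
  rewrite {1}/Q big_ord_recr /= -/(Q n).
  by rewrite -mulr_powRB1 ?(ltW (Q0 n))// ler_pM2l// ltW.
have lQ0 n : 0 <= ln (Q n) by rewrite ln_ge0.
have QN k : ln (Q (N + k)%N) <= b ^+ (N + k) * ln (Q N).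
  elim: k => [|k IH].
    by rewrite addn0 ler_peMl// exprn_ege1.
  rewrite addnS; apply: le_trans (QS _ (leq_addr _ _)) _.
  by rewrite exprS -mulrA ler_pM2l.
have [N1 _ NP1] := E_inf_ln_index Ex.
have bc1 : 1 < c / b by rewrite ltr_pdivlMr// mul1r.
(* The constant comes from the chain [c^(n+1) / 2 < psi n.+1 / 2 < ln (e + 1) <= 1 + b^(n+1) ln (Q
   N) <= b^(n+1) (1 + ln (Q N))]. *)
have [N2 _ NP2] := near_exprn_ge (2 * (1 + ln (Q N))) bc1.
rewrite lnV in cV.
have [n] := @limn_esup_gt_frequently _ _ _ (maxn N (maxn N1 N2)).+1 cV.
case: n => // n; rewrite ltnS !geq_max => /and3P[Nn N1n N2n].
rewrite lte_fin ltr_pdivlMr// mulrC mulr_natl -lnXn; last by lra.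
rewrite ltr_ln ?posrE ?psi_gt0 ?exprn_gt0//; last by lra.
move=> cpsi; have psie := NP1 _ N1n.
have := NP2 n.+1 (leqW N2n).
apply/negP; rewrite -ltNge expr_div_n ltr_pdivrMr ?exprn_gt0//.
(* The summand 1 pays for [e + 1 <= 2 e <= exp 1 * Q n.+1]. *)
have le1 : ln (luroth_index n x).+1%:R <= 1 + b ^+ n.+1 * ln (Q N).
  have := QN (n.+1 - N)%N; rewrite subnKC ?leqW// => h.
  apply: le_trans (lerD (lexx 1) h).
  apply: (@le_trans _ _ (ln (expR 1 * Q n.+1))); last first.
    by rewrite lnM ?posrE ?expR_gt0// expRK.
  rewrite ler_ln ?posrE ?mulr_gt0 ?expR_gt0//.
  have Qe : (luroth_index n x)%:R <= Q n.+1.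
    by rewrite /Q big_ord_recr /= -/(Q n) ler_peMl// Q1.
  have : 2 <= expR 1 :> R by apply: le_trans (expR_ge1Dx 1); lra.
  have := e1 n; rewrite -natr1; nra.
have b1n : 1 <= b ^+ n.+1 by exact: exprn_ege1.
by have := lQ0 N; nra.
Qed.

End E_inf_digits.

(** * Lower bound *)

Section cantor_digits.
Context {R : realType}.
Variable m : nat -> nat.
Hypothesis m_ge2 : forall n, (2 <= m n)%N.

(** For [t] in [[0, 1[] this is the fractional part of [m_0 ... m_(n-1) t]; it plays the part that
    [T^n] plays for Lueroth expansions. *)
Fixpoint cantor_rem (n : nat) (t : R) : R := if n is n'.+1 then
  (m n')%:R * cantor_rem n' t - (Num.trunc ((m n')%:R * cantor_rem n' t))%:R
  else t.

Definition cantor_digit (n : nat) (t : R) : nat :=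
  Num.trunc ((m n)%:R * cantor_rem n t).

Lemma cantor_rem_itv n t : 0 <= t < 1 -> 0 <= cantor_rem n t < 1.
Proof.
move=> t01; elim: n => //= n /andP[r0 r1].
have /truncn_itv/andP[] : 0 <= (m n)%:R * cantor_rem n t by rewrite mulr_ge0.
by rewrite -natr1; lra.
Qed.

Lemma cantor_digit_lt n t : 0 <= t < 1 -> (cantor_digit n t < m n)%N.
Proof.
move=> /(cantor_rem_itv n)/andP[r0 r1].
have /truncn_itv/andP[h _] : 0 <= (m n)%:R * cantor_rem n t by rewrite mulr_ge0.
rewrite -(@ltr_nat R); apply: le_lt_trans h _.
by rewrite -[ltRHS]mulr1 ltr_pM2l// ltr0n (leq_trans _ (m_ge2 n)).
Qed.

Lemma cantor_rem_sub n t u :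
  (forall i, (i < n)%N -> cantor_digit i t = cantor_digit i u) ->
  cantor_rem n t - cantor_rem n u = (\prod_(i < n) m i)%:R * (t - u).
Proof.
elim: n => [|n IH] tu /=; first by rewrite big_ord0 mul1r.
rewrite big_ord_recr /= natrM mulrAC -IH; last by move=> i ni; rewrite tu// ltnW.
have := tu _ (ltnSn n); rewrite /cantor_digit => ->.
by ring.
Qed.

(** If all digits agreed, [|t - u|] times [m_0 ... m_(n-1) >= 2^n] would stay below 1. *)
Lemma cantor_digit_neq t u : 0 <= t < 1 -> 0 <= u < 1 -> t != u ->
  exists n, cantor_digit n t != cantor_digit n u.
Proof.
move=> t01 u01 tu; apply: contrapT => nP.
have tuE i : cantor_digit i t = cantor_digit i u.
  by apply/eqP/negP => /negP h; apply: nP; exists i.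
have tu0 : 0 < `|t - u| by rewrite normr_gt0 subr_eq0.
have [n _ /(_ n (leqnn n)) /= nP'] :=
  near_exprn_ge `|t - u|^-1 (ltr1n R 2 : 1 < 2).
have /andP[rt0 rt1] := cantor_rem_itv n t01.
have /andP[ru0 ru1] := cantor_rem_itv n u01.
have /(congr1 Num.norm) := cantor_rem_sub (fun i (_ : (i < n)%N) => tuE i).
rewrite normrM normr_nat => h.
have : `|cantor_rem n t - cantor_rem n u| < 1 by rewrite ltr_norml; lra.
rewrite h; apply/negP; rewrite -leNgt.
rewrite -ler_pdivrMr// mul1r; apply: le_trans nP' _.
rewrite -natrX ler_nat; elim: (n) => [|k IH]; first by rewrite big_ord0.
by rewrite expnS mulnC big_ord_recr leq_mul.
Qed.

(** With [k] the difference of the digits, the scaled remainders differ by less than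
    [k + 1 <= 2 k]. *)
Lemma cantor_digit_sub n t u : 0 <= t < 1 -> 0 <= u < 1 ->
  (forall i, (i < n)%N -> cantor_digit i t = cantor_digit i u) ->
  (cantor_digit n t < cantor_digit n u)%N ->
  `|t - u| <= 2 * (cantor_digit n u - cantor_digit n t)%:R
    / ((\prod_(i < n) m i)%:R * (m n)%:R).
Proof.
move=> t01 u01 tuE tu.
have M0 : 0 < (\prod_(i < n) m i)%:R :> R.
  by rewrite natr_prod prodr_gt0// => i _; rewrite ltr0n (leq_trans _ (m_ge2 i)).
have m0 : 0 < (m n)%:R :> R by rewrite ltr0n (leq_trans _ (m_ge2 n)).
rewrite ler_pdivlMr ?mulr_gt0// mulrA -{1}(gtr0_norm M0) -normrM mulrC.
rewrite [_ * (\prod_(i < n) m i)%:R]mulrC -cantor_rem_sub//.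
rewrite -{1}(gtr0_norm m0) -normrM mulrBr natrB ?(ltnW tu)//.
have /andP[rt0 _] := cantor_rem_itv n t01.
have /andP[ru0 _] := cantor_rem_itv n u01.
have /truncn_itv : 0 <= (m n)%:R * cantor_rem n t by rewrite mulr_ge0.
have /truncn_itv : 0 <= (m n)%:R * cantor_rem n u by rewrite mulr_ge0.
rewrite -/(cantor_digit n t) -/(cantor_digit n u) -!natr1.
move: tu; rewrite -(@ler_nat R) -natr1.
by move=> tu /andP[? ?] /andP[? ?]; rewrite ler_norml; lra.
Qed.

(** This inverts the reading of [e_n - m_n] as mixed-base digits, and is the [g] of
    [hausdorff_measure_gt0]. *)
Definition cantor_point (t : R) : R :=
  luroth_series (fun n => m n + cantor_digit n t)%N 0.

Lemma cantor_point_gt0_le1 t : 0 < cantor_point t <= 1.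
Proof.
have e0 n : (0 < m n + cantor_digit n t)%N.
  by rewrite addn_gt0 (leq_trans _ (m_ge2 n)).
by rewrite luroth_series_gt0// luroth_series_le1.
Qed.

Lemma luroth_index_cantor_point n t :
  luroth_index n (cantor_point t) = (m n + cantor_digit n t)%N.
Proof.
by rewrite luroth_index_series// => k; rewrite addn_gt0 (leq_trans _ (m_ge2 k)).
Qed.

(** All indices are below [2 m_i], so [T^n] stretches distances by at most
    [4^n (m_0 ... m_(n-1))^2]; the images under [T^n] are at least [k / (8 m_n^2)] apart. *)
Lemma cantor_point_sub n t u : 0 <= t < 1 -> 0 <= u < 1 ->
  (forall i, (i < n)%N -> cantor_digit i t = cantor_digit i u) ->
  (cantor_digit n t < cantor_digit n u)%N ->
  (cantor_digit n u - cantor_digit n t)%:R / (m n)%:R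
    / (8 * 4 ^+ n * (m n)%:R * (\prod_(i < n) m i)%:R ^+ 2)
  <= `|cantor_point t - cantor_point u|.
Proof.
move=> t01 u01 tuE tu.
pose et i := (m i + cantor_digit i t)%N; pose eu i := (m i + cantor_digit i u)%N.
have et0 i : (0 < et i)%N by rewrite addn_gt0 (leq_trans _ (m_ge2 i)).
have eu0 i : (0 < eu i)%N by rewrite addn_gt0 (leq_trans _ (m_ge2 i)).
have := @luroth_iter_sub R n _ _ (cantor_point_gt0_le1 t) (cantor_point_gt0_le1 u).
have eqi i : (i < n)%N -> luroth_index i (cantor_point t) =
    luroth_index i (cantor_point u).
  by move=> ni; rewrite !luroth_index_cantor_point tuE.
move=> /(_ eqi); rewrite /cantor_point !luroth_iter_series//.
rewrite -!/(cantor_point _); set P : R := _%:R => xyP.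
set M : R := (\prod_(i < n) m i)%:R; set k : R := (_ - _)%:R; set mn : R := (m n)%:R.
have M0 : 0 < M.
  by rewrite /M natr_prod prodr_gt0// => i _; rewrite ltr0n (leq_trans _ (m_ge2 i)).
have m0 : 0 < mn by rewrite ltr0n (leq_trans _ (m_ge2 n)).
have P0 : 0 < P.
  rewrite /P natr_prod prodr_gt0// => i _.
  by rewrite ltr0n muln_gt0 luroth_index_gt0// cantor_point_gt0_le1.
have PM : P <= 4 ^+ n * M ^+ 2.
  have -> : 4 ^+ n * M ^+ 2 = \prod_(i < n) (4 * (m i)%:R ^+ 2).
    rewrite big_split /= prodr_const card_ord prodrXl -natr_prod//.
  rewrite /P natr_prod; apply: ler_prod => i _; rewrite ler0n /=.
  rewrite luroth_index_cantor_point -natrX -[4]/(4%:R) -natrM ler_nat.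
  have := cantor_digit_lt i t01; move: (cantor_digit i t) => a am.
  have -> : (4 * m i ^ 2 = (m i + m i) * (m i + m i))%N by rewrite -mulnn addnn -mul2n; ring.
  by rewrite leq_mul// -?addnS ?leq_add2l// ltnW.
suff le8 : k / (8 * mn ^+ 2) <= `|luroth_series et n - luroth_series eu n|.
  move: le8; rewrite xyP normrM (gtr0_norm P0) => le8.
  rewrite -ler_pdivrMl// in le8; apply: le_trans le8.
  rewrite ler_pdivlMl//.
  have -> : P * (k / mn / (8 * 4 ^+ n * mn * M ^+ 2)) =
      k / (8 * mn ^+ 2) * (P / (4 ^+ n * M ^+ 2)).
    by field; rewrite !gt_eqF ?exprn_gt0.
  rewrite ler_piMr ?divr_ge0 ?mulr_ge0 ?exprn_ge0 ?(ltW m0)//.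
  by rewrite ler_pdivrMr ?mul1r// mulr_gt0 ?exprn_gt0.
apply: le_trans (ler_norm _); rewrite [luroth_series et n]luroth_seriesE//.
rewrite [luroth_series eu n]luroth_seriesE//.
have x0 : 0 <= luroth_series et n.+1 / (et n * (et n).+1)%:R :> R.
  by rewrite divr_ge0 ?luroth_series_ge0.
(* As the next index is at least 2, the point of larger index stays in the lower half of its
   interval. This leaves a gap even between adjacent indices. *)
have y0 : luroth_series eu n.+1 <= 2^-1 :> R.
  apply: le_trans (luroth_series_le eu0 n.+1) _.
  by rewrite lef_pV2 ?posrE ?ltr0n// ler_nat (leq_trans (m_ge2 n.+1))// leq_addr.
have kE : k = (eu n)%:R - (et n)%:R.
  by rewrite /k /eu /et natrB ?(ltnW tu)// !natrD; ring.
have a0 : 0 < (et n)%:R :> R by rewrite ltr0n.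
have c0 : 0 < (eu n)%:R :> R by rewrite ltr0n.
have ac : (et n)%:R + 1 <= (eu n)%:R :> R.
  by rewrite natr1 ler_nat /et /eu -addnS leq_add2l.
have cm : (eu n)%:R + 1 <= 2 * mn.
  by rewrite natr1 -natrM ler_nat mul2n -addnn /eu -addnS leq_add2l cantor_digit_lt.
have y1 : luroth_series eu n.+1 / (eu n * (eu n).+1)%:R <=
    2^-1 * ((eu n)%:R^-1 - (eu n).+1%:R^-1) :> R.
  apply: (@le_trans _ _ (2^-1 / (eu n * (eu n).+1)%:R)).
    by rewrite ler_wpM2r ?invr_ge0.
  rewrite natrM -natr1 le_eqVlt; apply/orP; left; apply/eqP; field.
  by rewrite gt_eqF//= gt_eqF// addr_gt0.
have ca : (eu n)%:R^-1 <= (et n).+1%:R^-1 :> R.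
  by rewrite lef_pV2 ?posrE ?ltr0n// -natr1.
(* Both [et n + 1] and [eu n + 1] are at most [2 m_n], and they differ by [k]. *)
have final : k / (8 * mn ^+ 2) <= 2^-1 * ((et n).+1%:R^-1 - (eu n).+1%:R^-1).
  have -> : 2^-1 * ((et n).+1%:R^-1 - (eu n).+1%:R^-1) =
      k / (2 * ((et n).+1%:R * (eu n).+1%:R)) :> R.
    rewrite kE -!natr1; field.
    by rewrite gt_eqF ?addr_gt0//= gt_eqF// addr_gt0.
  rewrite ler_wpM2l// lef_pV2 ?posrE ?mulr_gt0 ?exprn_gt0//.
  rewrite -!natr1.
  have : ((et n)%:R + 1) * ((eu n)%:R + 1) <= (2 * mn) * (2 * mn).
    by apply: ler_pM; lra.
  by rewrite expr2; lra.
move: final x0 y1 ca.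
move: (k / _) (luroth_series et _ / _) (luroth_series eu _ / _) => c X Y.
move: ((et n).+1%:R^-1 : R) ((eu n).+1%:R^-1 : R) ((eu n)%:R^-1 : R).
move=> a' b' c'.
lra.
Qed.

(** The growth hypothesis yields the Hoelder bound: for points whose digits first differ at [n],
    combine [cantor_digit_sub] with the [s]-th power of [cantor_point_sub], where
    [k / m_n <= (k / m_n)^s] because [k <= m_n] and [s <= 1]. *)
Lemma cantor_set_hausdorff_gt0 (s C : R) (E : set R) : 0 <= s <= 1 -> 0 < C ->
  (forall n, (8 * 4 ^+ n * (m n)%:R * (\prod_(i < n) m i)%:R ^+ 2) `^ s <=
     C * (\prod_(i < n) m i)%:R) ->
  (forall x : R, 0 < x <= 1 ->
     (forall n, (m n <= luroth_index n x < 2 * m n)%N) -> E x) ->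
  (0 < hausdorff_measure s E)%E.
Proof.
move=> /andP[s0 s1] C0 HC EP.
apply: (@hausdorff_measure_gt0 R s (2 * C) E cantor_point) => //.
- by rewrite mulr_gt0.
- move=> t t01; apply: EP; first exact: cantor_point_gt0_le1.
  move=> n; rewrite luroth_index_cantor_point leq_addr /= mul2n -addnn ltn_add2l.
  exact: cantor_digit_lt.
have wlog_lt n t u : 0 <= t < 1 -> 0 <= u < 1 ->
    (forall i, (i < n)%N -> cantor_digit i t = cantor_digit i u) ->
    (cantor_digit n t < cantor_digit n u)%N ->
    `|t - u| <= 2 * C * `|cantor_point t - cantor_point u| `^ s.
  move=> t01 u01 tuE tu.
  apply: le_trans (cantor_digit_sub t01 u01 tuE tu) _.
  have := cantor_point_sub t01 u01 tuE tu.
  have := HC n; set M : R := (\prod_(i < n) m i)%:R.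
  set A : R := (8 * _ * _ * _); set k : R := (_ - _)%:R; set mn : R := (m n)%:R.
  have M0 : 0 < M.
    by rewrite /M natr_prod prodr_gt0// => i _; rewrite ltr0n (leq_trans _ (m_ge2 i)).
  have m0 : 0 < mn by rewrite ltr0n (leq_trans _ (m_ge2 n)).
  have A0 : 0 < A by rewrite !mulr_gt0 ?exprn_gt0.
  have k0 : 0 < k by rewrite ltr0n subn_gt0.
  have km : k / mn <= 1.
    rewrite ler_pdivrMr// mul1r ler_nat (leq_trans (leq_subr _ _))//.
    by rewrite ltnW// cantor_digit_lt.
  move=> AM kA.
  apply: (@le_trans _ _ (2 * C * (k / mn / A) `^ s)); last first.
    rewrite ler_pM2l ?mulr_gt0// ge0_ler_powR ?nnegrE//.
    by rewrite !divr_ge0 ?ltW.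
  rewrite powRM ?invr_ge0 ?divr_ge0 ?(ltW k0) ?(ltW A0) ?(ltW m0)//.
  have -> : A^-1 `^ s = (A `^ s)^-1.
    by rewrite -powR_inv1 ?(ltW A0)// powRAC powR_inv1// powR_ge0.
  have kk : k / mn <= (k / mn) `^ s.
    by rewrite ger1_powR// km andbT divr_gt0.
  rewrite mulrA ler_pdivlMr ?powR_gt0//.
  apply: (@le_trans _ _ (2 * k / (M * mn) * (C * M))).
    by rewrite ler_pM2l// divr_gt0 ?mulr_gt0.
  have -> : 2 * k / (M * mn) * (C * M) = 2 * C * (k / mn).
    by field; rewrite !gt_eqF.
  by rewrite ler_pM2l// mulr_gt0.
move=> t u t01 u01.
have [->|tu] := eqVneq t u.
  by rewrite subrr normr0 !mulr_ge0 ?powR_ge0// ltW.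
have ex := cantor_digit_neq t01 u01 tu.
case: (ex_minnP ex) => n dn nmin.
have tuE i : (i < n)%N -> cantor_digit i t = cantor_digit i u.
  by move=> ni; apply/eqP; apply: contraTT ni => /nmin; rewrite -leqNgt.
move: dn; rewrite neq_ltn => /orP[tu'|tu'].
  exact: (wlog_lt n).
rewrite distrC [X in X `^ _]distrC; apply: (wlog_lt n) => // i /tuE.
by [].
Qed.

End cantor_digits.

(** * Majorants of bounded growth ratio *)

Section envelope.
Context {R : realType}.

Lemma seq_argmax (a : nat -> R) N K : exists2 k, (N <= k)%N &
  forall j, (N <= j <= N + K)%N -> a j <= a k.
Proof.
elim: K => [|K [k Nk kmax]].
  by exists N => // j; rewrite addn0 -eqn_leq => /eqP ->.
have [ak|/ltW ak] := leP (a (N + K).+1) (a k).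
  exists k => // j; rewrite addnS (leq_eqVlt j) ltnS andb_orr => /orP[|/kmax//].
  by move=> /andP[_ /eqP ->].
exists (N + K).+1; first by rewrite leqW// leq_addr.
move=> j; rewrite addnS (leq_eqVlt j) ltnS andb_orr => /orP[|/kmax/le_trans]; last exact.
by move=> /andP[_ /eqP ->].
Qed.

(* The least majorant [c] of [phi] with growth ratio at most [B] is
   [c n = sup_(k >= n) phi k * B ^ (n - k)]; it touches [phi] wherever the
   supremum is attained at [k = n]. *)
Lemma geometric_envelope (phi : nat -> R) (B : R) :
  (forall n, 0 < phi n) -> 0 < B ->
  (forall eps : R, 0 < eps -> \forall n \near \oo, phi n <= eps * B ^+ n) ->
  exists c : nat -> R, [/\ forall n, phi n <= c n,
    forall n, c n.+1 <= B * c n &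
    forall N, exists2 n, (N <= n)%N & c n = phi n].
Proof.
move=> phi0 B0 phiB.
have BX n : 0 < B ^+ n by exact: exprn_gt0.
pose a n := phi n / B ^+ n.
have a0 n : 0 < a n by rewrite divr_gt0.
(* Since [a] is eventually at most [a N], its supremum over [[N, oo[] is attained in a finite
   window. *)
have peak N : exists2 k, (N <= k)%N & forall j, (N <= j)%N -> a j <= a k.
  have [N1 _ NP1] := phiB _ (a0 N).
  have [k Nk kmax] := seq_argmax a N N1.
  exists k => // j Nj; have [jN|/ltnW jN] := leqP j (N + N1).
    by apply: kmax; rewrite Nj.
  apply: (@le_trans _ _ (a N)); last by apply: kmax; rewrite leqnn leq_addr.
  rewrite {1}/a ler_pdivrMr//; apply: NP1 => /=.
  exact: leq_trans (leq_addl _ _) jN.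
pose A n := [set a j | j in [set j | (n <= j)%N]].
have supA n : has_sup (A n).
  split; first by exists (a n); exists n => /=.
  by have [k _ kmax] := peak n; exists (a k) => _ [j nj <-]; exact: kmax.
have aA n : a n <= sup (A n).
  by apply: sup_upper_bound => //; exists n => /=.
exists (fun n => B ^+ n * sup (A n)); split.
- by move=> n; rewrite mulrC -ler_pdivrMr//; exact: aA.
- move=> n; rewrite exprS -mulrA !ler_pM2l//.
  apply: ge_sup; first exact: (supA n.+1).1.
  move=> _ [j nj <-]; apply: sup_upper_bound => //.
  by exists j => //=; exact: ltnW.
- move=> N; have [k Nk kmax] := peak N; exists k => //.
  suff -> : sup (A k) = a k by rewrite mulrC divfK ?gt_eqF.
  apply/eqP; rewrite eq_le aA andbT.
  apply: ge_sup; first exact: (supA k).1.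
  by move=> _ [j kj <-]; apply: kmax; exact: leq_trans kj.
Qed.

End envelope.

Section lower.
Context {R : realType}.
Variable psi : nat -> R.
Hypothesis psi_gt0 : forall n : nat, (0 < n)%N -> 0 < psi n.
Hypothesis psi_cvg : psi n @[n --> \oo] --> +oo.

Section envelope_digits.
Variable c : nat -> R.
Hypothesis c_ge : forall n, psi n.+1 <= c n.
Hypothesis c_eq : forall N, exists2 n, (N <= n)%N & c n = psi n.+1.

(** Adding 2 ensures both [m n >= 2] and [m n > exp (c n)]. The shift from [c n] to [psi n.+1]
    matches [luroth_index n] with the digit [d_(n+1)]. *)
Let m n := (Num.trunc (expR (c n))).+2.

Let c_gt0 n : 0 < c n.
Proof. by apply: lt_le_trans (c_ge n); exact: psi_gt0. Qed.

Let expR_lt_m n : expR (c n) < (m n)%:R.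
Proof. by apply: lt_trans (truncnS_gt _) _; rewrite ltr_nat. Qed.

Let m_le_expR n : (m n)%:R <= 3 * expR (c n).
Proof.
have /truncn_itv/andP[h _] : 0 <= expR (c n) by rewrite expR_ge0.
have : 1 <= expR (c n) by rewrite -expR0 ler_expR ltW.
by rewrite /m -!natr1; lra.
Qed.

(** Here [c n <= ln d_(n+1) <= c n + ln 6], with [6 = 2 * 3] from [d <= 2 m] and [m <= 3 exp c]. The
    ratio is thus always at least 1, and at most [1 + ln 6 / psi] wherever [c] touches [psi]. *)
Lemma envelope_E_inf (x : R) : 0 < x <= 1 ->
  (forall n, (m n <= luroth_index n x < 2 * m n)%N) -> E_inf psi x.
Proof.
move=> x01 xm; split => //.
have ln_ge n : c n <= ln (luroth_digit n.+1 x)%:~R.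
  rewrite luroth_digit_index// -[leLHS]expRK ler_ln ?posrE ?expR_gt0 ?ltr0n//.
  apply: ltW; apply: lt_le_trans (expR_lt_m n) _.
  by rewrite ler_nat leqW//; case/andP: (xm n).
have ln_le n : ln (luroth_digit n.+1 x)%:~R <= c n + ln 6.
  rewrite luroth_digit_index// -[X in X + _](expRK (c n)) -lnM ?posrE ?expR_gt0//.
  rewrite ler_ln ?posrE ?mulr_gt0 ?expR_gt0 ?ltr0n//.
  apply: (@le_trans _ _ (2 * (m n)%:R)).
    by rewrite -[2]/(2%:R) -natrM ler_nat; case/andP: (xm n).
  by have := m_le_expR n; lra.
apply/eqP; rewrite eq_le; apply/andP; split; last first.
  apply: le_limn_einf; exists 1%N => // -[//|n] _ /=.
  rewrite lee_fin ler_pdivlMr ?psi_gt0// mul1r.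
  exact: le_trans (ln_ge n).
apply/lee_addgt0Pr => eps e0; apply: limn_einf_le => N.
have /cvgryPge/(_ (ln 6 / eps))[N1 _ NP1] := psi_cvg.
have [n] := c_eq (maxn N N1); rewrite geq_max => /andP[Nn N1n] cE.
exists n.+1; first exact: leqW.
rewrite -EFinD lee_fin ler_pdivrMr ?psi_gt0//.
apply: le_trans (ln_le n) _; rewrite cE mulrDl mul1r lerD2l.
by rewrite mulrC -ler_pdivrMr//; apply: NP1 => /=; exact: leqW.
Qed.

(** Let [L] be the logarithm of the product. As [c n <= c 0 + (B - 1) L], the left side has
    logarithm at most [s (1 + B) L] plus a constant and [n ln 4]. The margin [d = 1 - s (1 + B)]
    absorbs [n ln 4], because [c] tends to infinity. *)
Lemma envelope_product_bound (s B : R) : 0 <= s <= 1 -> 1 <= B ->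
  s * (1 + B) < 1 -> (forall n, c n.+1 <= B * c n) ->
  exists2 C : R, 0 < C & forall n,
    (8 * 4 ^+ n * (m n)%:R * (\prod_(i < n) m i)%:R ^+ 2) `^ s <=
      C * (\prod_(i < n) m i)%:R.
Proof.
move=> /andP[s0 s1] B1 sB cB.
pose S n : R := \sum_(i < n) c i.
pose M n : R := (\prod_(i < n) m i)%:R.
have m0 n : 0 < (m n)%:R :> R by rewrite ltr0n.
have M0 n : 0 < M n by rewrite /M natr_prod prodr_gt0.
have S0 n : 0 <= S n by apply: sumr_ge0 => i _; exact: ltW.
have SM n : S n <= ln (M n).
  elim: n => [|n IH]; first by rewrite /S /M !big_ord0 ln1.
  rewrite /S /M !big_ord_recr /= natrM lnM ?posrE ?M0//.
  rewrite lerD// -[leLHS]expRK ler_ln ?posrE ?expR_gt0//.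
  exact: ltW.
have cS n : c n <= c 0%N + (B - 1) * S n.
  elim: n => [|n IH]; first by rewrite /S big_ord0 mulr0 addr0.
  rewrite /S big_ord_recr /= -/(S n); apply: le_trans (cB n) _.
  have -> : B * c n = c n + (B - 1) * c n by ring.
  by rewrite mulrDr addrA lerD2r.
pose d := 1 - s * (1 + B); have d0 : 0 < d by rewrite subr_gt0.
have ln4 : 0 <= ln 4 :> R by rewrite ln_ge0// ler1n.
have [N1 _ NP1] : \forall n \near \oo, ln 4 / d <= psi n.
  by have /cvgryPge := psi_cvg; exact.
(* From [N1] on each new term contributes [d * c n >= ln 4]; the first [N1] steps go into the
   constant. *)
have dS n : n%:R * ln 4 <= N1%:R * ln 4 + d * S n.
  elim: n => [|n IH]; first by rewrite mul0r addr_ge0 ?mulr_ge0 ?(ltW d0).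
  have [nN|Nn] := ltnP n N1.
    apply: (@le_trans _ _ (N1%:R * ln 4)); first by rewrite ler_wpM2r// ler_nat.
    by rewrite lerDl mulr_ge0 ?(ltW d0).
  have : ln 4 <= d * c n.
    rewrite mulrC -ler_pdivrMr//; apply: le_trans (c_ge n).
    by apply: NP1 => /=; exact: leqW.
  rewrite /S big_ord_recr /= -/(S n) -(natr1 n).
  by move=> ?; rewrite mulrDl mul1r mulrDr addrA lerD.
pose K : R := ln 8 + ln 3 + c 0%N + N1%:R * ln 4.
exists (expR K) => [|n]; first exact: expR_gt0.
rewrite -/(M n) -ler_ln ?posrE ?powR_gt0 ?mulr_gt0 ?exprn_gt0 ?expR_gt0//.
rewrite ln_powR !lnM ?posrE ?mulr_gt0 ?exprn_gt0 ?expR_gt0// expRK !lnXn//.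
have lm : ln (m n)%:R <= ln 3 + c n.
  rewrite -[X in _ + X]expRK -lnM ?posrE ?expR_gt0//.
  by rewrite ler_ln ?posrE ?mulr_gt0 ?expR_gt0.
have := dS n; have := cS n; have := SM n; have := S0 n.
rewrite -[ln 4 *+ n]mulr_natl.
have ln8 : 0 <= ln 8 :> R by rewrite ln_ge0// ler1n.
have ln3 : 0 <= ln 3 :> R by rewrite ln_ge0// ler1n.
have c0 := c_gt0 0%N.
have : 0 <= n%:R * ln 4 :> R by rewrite mulr_ge0.
move: (n%:R * ln 4) (ln (M n)) (S n) => x L Sn x0 Sn0 SL cn x4.
have BL : (B - 1) * Sn <= (B - 1) * L by rewrite ler_wpM2l// subr_ge0.
have dL : d * Sn <= d * L by rewrite ler_wpM2l// ltW.
pose A := ln 8 + ln 3 + c 0%N + x.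
have A0 : 0 <= A by rewrite !addr_ge0// ltW.
apply: (@le_trans _ _ (s * (A + (1 + B) * L))).
  rewrite ler_wpM2l// /A.
  have -> : (1 + B) * L = (B - 1) * L + 2 * L by ring.
  by lra.
rewrite mulrDr mulrA; have -> : s * (1 + B) = 1 - d by rewrite /d; ring.
have sA : s * A <= A by rewrite ler_piMl.
rewrite mulrBl mul1r /K; move: sA; rewrite /A; lra.
Qed.

End envelope_digits.

Lemma E_inf_hausdorff_gt0 (v s : R) : 1 <= v ->
  lne v%:E = limn_esup (fun n : nat => (ln (psi n) / n%:R)%:E) ->
  0 <= s -> s * (1 + v) < 1 -> (0 < hausdorff_measure s (E_inf psi))%E.
Proof.
move=> v1 lnV s0 sv.
have s1 : s <= 1 by nra.
(* This gives [s (1 + B) <= 1 - 2 eta + eta < 1]. The intermediate base [B0] bounds [psi n], and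
   [B / B0 > 1] then gives the decay relative to [B^n] that the envelope requires. *)
pose eta := (1 - s * (1 + v)) / 2.
have eta0 : 0 < eta by rewrite /eta; lra.
pose B := v + eta; pose B0 := v + eta / 2.
have B00 : 0 < B0 by rewrite /B0; lra.
have Bgt0 : 0 < B by rewrite /B; lra.
have psiB : \forall n \near \oo, psi n <= B0 ^+ n.
  have : (limn_esup (fun n : nat => (ln (psi n) / n%:R)%:E) < (ln B0)%:E)%E.
    have v0 : 0 < v by exact: lt_le_trans v1.
    by rewrite -lnV lne_EFin// lte_fin ltr_ln ?posrE// /B0; lra.
  move=> /limn_esup_lt_near[N _ NP]; exists N.+1 => // -[//|n] /= Nn.
  have := NP n.+1 (ltnW Nn); rewrite lte_fin ltr_pdivrMr// mulr_natr -lnXn//.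
  by rewrite ltr_ln ?posrE ?psi_gt0 ?exprn_gt0// => /ltW.
have phiB eps : 0 < eps -> \forall n \near \oo, psi n.+1 <= eps * B ^+ n.
  move=> e0; have BB : 1 < B / B0 by rewrite ltr_pdivlMr// mul1r /B /B0; lra.
  have [N1 _ NP1] := near_exprn_ge (B0 / eps) BB.
  have [N2 _ NP2] := psiB.
  exists (maxn N1 N2) => // n; rewrite /= geq_max => /andP[N1n N2n].
  apply: le_trans (NP2 n.+1 (leqW N2n)) _.
  have := NP1 n N1n; rewrite expr_div_n /= ler_pdivlMr ?exprn_gt0//.
  by rewrite mulrAC -exprS ler_pdivrMr// mulrC.
have [c [c_ge cB c_eq]] := @geometric_envelope R (fun n => psi n.+1) B
  (fun n => psi_gt0 (ltn0Sn n)) Bgt0 phiB.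
have B1 : 1 <= B by rewrite /B; lra.
have s01 : 0 <= s <= 1 by rewrite s0.
have sB : s * (1 + B) < 1.
  have : s * eta <= eta by rewrite ler_piMl// ltW.
  by rewrite /B /eta; lra.
have [C C0 HC] := envelope_product_bound c_ge s01 B1 sB cB.
apply: (@cantor_set_hausdorff_gt0 R _ _ s C) HC _ => //.
exact: envelope_E_inf.
Qed.

End lower.

(** * The Hausdorff dimension of [E_inf psi] *)

Lemma E_inf_hausdorff_eq0 (R : realType) (psi : nat -> R) (V : \bar R)
    (s b : R) : (forall n, (0 < n)%N -> 0 < psi n) ->
  psi n @[n --> \oo] --> +oo ->
  lne V = limn_esup (fun n : nat => (ln (psi n) / n%:R)%:E) ->
  0 < s -> 1 <= b -> b = 1 \/ (b%:E < V)%E -> 1 < s * (1 + b) ->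
  hausdorff_measure s (E_inf psi) = 0%E.
Proof.
move=> psi_gt0 psi_cvg lnV s0 b1 bV sb.
apply: (@hausdorff_measure_luroth_eq0 R s b) => // x Ex; split.
- by case: Ex.
- exact: (E_inf_index_cvg psi_gt0 psi_cvg Ex).
- exact: (E_inf_growth psi_gt0 lnV b1 bV Ex).
Qed.

Theorem theorem1p3 (R : realType) (psi : nat -> R)
    (psi_gt0 : forall n : nat, (0 < n)%N -> 0 < psi n)
    (psi_cvg : psi n @[n --> \oo] --> +oo)
    (V : \bar R) (V_ge1 : (1 <= V)%E)
    (lnV : lne V = limn_esup (fun n : nat => (ln (psi n) / n%:R)%:E)) :
  hausdorff_dim (E_inf psi) = ((1 + V)^-1)%E.
Proof.
have [r [r0 rV upper]] : exists r : R, [/\ 0 <= r, ((1 + V)^-1)%E = r%:E &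
    forall s, r < s -> exists b : R, [/\ 1 <= b, b = 1 \/ (b%:E < V)%E &
      1 < s * (1 + b)]].
  case: V V_ge1 {lnV} => [v| |]//; rewrite ?lee_fin => v1.
    exists (1 + v)^-1; have v0 : 0 < 1 + v by lra.
    split; first by rewrite invr_ge0 ltW.
      by rewrite -EFinD inver gt_eqF.
    move=> s vs; have {}vs : 1 < s * (1 + v) by rewrite -ltr_pdivrMr// mul1r.
    have s0 : 0 < s by nra.
    (* For [v = 1] no [b] satisfies [1 <= b < v], so [b = 1] is taken. *)
    have [v1E|vn1] := eqVneq v 1; first by exists v; split => //; left.
    have {}v1 : 1 < v by rewrite lt_neqAle eq_sym vn1.
    have sv : s^-1 < 1 + v by rewrite -[ltLHS]mul1r ltr_pdivrMr// mulrC.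
    (* The midpoint of [s^-1 - 1] and [v] is below [v], and makes [s (1 + b)] the mean of 1 and
       [s (1 + v) > 1]. *)
    exists (Num.max 1 ((v + s^-1 - 1) / 2)); split.
    - by rewrite le_max lexx.
    - by right; rewrite lte_fin gt_max v1 /=; lra.
    - apply: (@lt_le_trans _ _ (s * (1 + (v + s^-1 - 1) / 2))); last first.
        by rewrite ler_pM2l// lerD2l le_max lexx orbT.
      have -> : s * (1 + (v + s^-1 - 1) / 2) = (s * (1 + v) + 1) / 2.
        by field; rewrite gt_eqF.
      by lra.
  exists 0; split => //.
  (* For infinite [V] this choice gives [s (1 + b) = 2 s + 1]. *)
  move=> s s0; exists (1 + s^-1); split; first by rewrite lerDl invr_ge0 ltW.
    by right; rewrite ltry.
  by rewrite !mulrDr mulfV ?gt_eqF//; lra.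
rewrite rV; apply/eqP; rewrite eq_le; apply/andP; split.
  apply/lee_addgt0Pr => eps e0; apply: ereal_inf_lbound.
  have rs : r < r + eps by rewrite ltrDl.
  have [b [b1 bV sb]] := upper _ rs.
  exists (r + eps) => //; split; first exact: le_trans r0 (ltW rs).
  by apply: E_inf_hausdorff_eq0 lnV _ b1 bV sb => //; exact: le_lt_trans rs.
apply: le_ereal_inf_tmp => _ [s [s0 Hs] <-]; rewrite lee_fin leNgt.
apply/negP => sr; move: Hs.
case: V V_ge1 lnV rV {upper} => [v| |]//; rewrite ?lee_fin => v1 lnV; last first.
  by rewrite addey// invey => -[r0E]; move: sr; rewrite -r0E ltNge s0.
have v0 : 0 < 1 + v by lra.
rewrite -EFinD inver gt_eqF// => -[rE].
move=> Hs; have : (0 < hausdorff_measure s (E_inf psi))%E.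
  apply: E_inf_hausdorff_gt0 v1 lnV s0 _ => //.
  by rewrite -ltr_pdivlMr// mul1r rE.
by rewrite Hs ltxx.
Qed.
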